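(* There is a lax double functor $\blacksquare\colon\mathbb{O}\mathbf{pen}(\mathsf{Petri})\to\mathbb{R}\mathbf{el}$ (the reachability semantics) that sends: (1) any object (set) $X$ to the underlying set $\mathbb{N}[X]$ of the free commutative monoid on $X$; (2) any vertical 1-morphism (function) $f\colon X\to Y$ to the underlying function of $\mathbb{N}[f]\colon\mathbb{N}[X]\to\mathbb{N}[Y]$; (3) any horizontal 1-cell, i.e. open Petri net $LX\xrightarrow{i}P\xleftarrow{o}LY$, to its reachability relation $$\blacksquare P=\{(x,y)\in\mathbb{N}[X]\times\mathbb{N}[Y] \mid o(y)\text{ is reachable from } i(x)\text{ in }P\}\subseteq\mathbb{N}[X]\times\mathbb{N}[Y];$$ (4) any 2-morphism $(f,\alpha,g)$ from $LX\xrightarrow{i}P\xleftarrow{o}LY$ to $LX'\xrightarrow{i'}P'\xleftarrow{o'}LY'$ (so $\alpha i=i'Lf$ and $\alpha o=o'Lg$) to the square in $\mathbb{R}\mathbf{el}$ with top $\blacksquare P\subseteq\mathbb{N}[X]\times\mathbb{N}[Y]$, bottom $\blacksquare P'\subseteq\mathbb{N}[X']\times\mathbb{N}[Y']$, left side $\mathbb{N}[f]$ and right side $\mathbb{N}[g]$ (the unique 2-morphism of $\mathbb{R}\mathbf{el}$ with this frame).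
   Context: **Petri nets.** $\mathbb{N}[S]$ is the free commutative monoid on the set $S$; $\mathbb{N}[g]$ is the homomorphism extending a function $g$. A Petri net is a pair of functions $s,t\colon T\to \mathbb{N}[S]$ ($T$ the set of transitions, $S$ the set of places). A morphism from $(s,t\colon T\to\mathbb{N}[S])$ to $(s',t'\colon T'\to\mathbb{N}[S'])$ is a pair of functions $(f\colon T\to T', g\colon S\to S')$ with $s' f=\mathbb{N}[g]s$, $t' f=\mathbb{N}[g]t$. This gives the category $\mathsf{Petri}$. $L\colon\mathsf{Set}\to\mathsf{Petri}$ sends $X$ to $\emptyset\rightrightarrows\mathbb{N}[X]$ (places $X$, no transitions). **Reachability.** A marking of $P=(s,t\colon T\to\mathbb{N}[S])$ is an element of $\mathbb{N}[S]$. A firing of $\tau\in T$ is a tuple $(\tau,m,n)$ with $m,n$ markings, $m\ge s(\tau)$ and $n+s(\tau)=m+t(\tau)$. A marking $n$ is reachable from $m$ if for some $k\ge1$ there are markings $m=m_1,\dots,m_k=n$ and firings $(\tau_i,m_i,m_{i+1})$, $1\le i\le k-1$ (so any marking is reachable from itself). For $i\colon LX\to P$ and $x\in\mathbb{N}[X]$, $i(x)\in\mathbb{N}[S]$ denotes the image of $x$ under the homomorphism $\mathbb{N}[X]\to\mathbb{N}[S]$ induced by the place component of $i$; likewise $o(y)$. **$\mathbb{O}\mathbf{pen}(\mathsf{Petri})$** is the double category with sets as objects; functions as vertical 1-morphisms; open Petri nets, i.e. cospans $LX\xrightarrow{i}P\xleftarrow{o}LY$ in $\mathsf{Petri}$,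 as horizontal 1-cells $X\to Y$; as 2-morphisms, triples $(f\colon X\to X',\alpha\colon P\to P',g\colon Y\to Y')$ with $\alpha i=i'Lf$, $\alpha o=o'Lg$. Horizontal 1-cells are composed by (chosen) pushouts over $LY$ in $\mathsf{Petri}$; horizontal composites of 2-morphisms are the induced maps on pushouts; vertical composition is componentwise. **$\mathbb{R}\mathbf{el}$** is the strict double category with sets as objects, functions as vertical 1-morphisms, relations $R\subseteq X\times Y$ as horizontal 1-cells from $X$ to $Y$ (with the usual composition of relations), and, for relations $R\subseteq X_1\times Y_1$, $S\subseteq X_2\times Y_2$ and functions $f\colon X_1\to X_2$, $g\colon Y_1\to Y_2$, exactly one 2-morphism from $R$ to $S$ with left side $f$ and right side $g$ if $(f\times g)R\subseteq S$, and none otherwise. **Double categories in general.** A double category $\mathbb{D}$ consists of categories $\mathbb{D}_0$ (objects, vertical 1-morphisms) and $\mathbb{D}_1$ (horizontal 1-cells, 2-morphisms), functors $S,T\colon\mathbb{D}_1\to\mathbb{D}_0$, $U\colon\mathbb{D}_0\to\mathbb{D}_1$, $\odot\colon\mathbb{D}_1\times_{\mathbb{D}_0}\mathbb{D}_1\to\mathbb{D}_1$ with $SU=TU=1$, $S(M\odot N)=SN$, $T(M\odot N)=TM$, and associator and unitor natural isomorphisms for $\odot$ with globular components (sent to identities by $S$ and $T$), satisfying pentagon and triangle identities; it is strict if these are identities. A lax double functor $F\colon\mathbb{A}\to\mathbb{B}$ consists of functors $F_0\colon\mathbb{A}_0\to\mathbb{B}_0$, $F_1\colon\mathbb{A}_1\to\mathbb{B}_1$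 with $SF_1=F_0S$, $TF_1=F_0T$, and natural transformations (not necessarily invertible) with globular components $\phi(N,N')\colon F_1(N)\odot F_1(N')\to F_1(N\odot N')$ and $\phi_A\colon U_{F_0(A)}\to F_1(U_A)$, compatible with associators and left and right unitors in the usual sense. *)

(* Defs.v *)
From mathcomp Require Import all_boot boolp classical_sets finmap multiset.
From Stdlib Require Import Relation_Operators.

Set Implicit Arguments.
Unset Strict Implicit.
Unset Printing Implicit Defensive.

Declare Scope cat_scope.
Delimit Scope cat_scope with cat.
Local Open Scope cat_scope.
Local Obligation Tactic := intros.

Record category := Category {
  ob :> Type;
  hom : ob -> ob -> Type;
  idm : forall A, hom A A;
  comp : forall A B C, hom B C -> hom A B -> hom A C;
  comp1m : forall A B (f : hom A B), comp (idm B) f = f;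
  compm1 : forall A B (f : hom A B), comp f (idm A) = f;
  compA : forall A B C D (h : hom C D) (g : hom B C) (f : hom A B),
    comp h (comp g f) = comp (comp h g) f }.

Arguments hom {c} A B.
Arguments idm {c} A.
Arguments comp {c A B C} g f.
Notation "g ∘ f" := (comp g f) (at level 40, left associativity) : cat_scope.

Record functor (A C : category) := Functor {
  fob :> A -> C;
  fmap : forall X Y : A, hom X Y -> hom (fob X) (fob Y);
  fmap1 : forall X, fmap (idm X) = idm (fob X);
  fmapM : forall X Y Z (g : hom Y Z) (f : hom X Y),
    fmap (g ∘ f) = fmap g ∘ fmap f }.

Record pushout (C : category) (Z P Q : C) (f : hom Z P) (g : hom Z Q) :=
  Pushout {
    po_ob : C;
    po_inl : hom P po_ob;
    po_inr : hom Q po_ob;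
    po_comm : po_inl ∘ f = po_inr ∘ g;
    po_desc : forall (W : C) (u : hom P W) (v : hom Q W),
      u ∘ f = v ∘ g -> hom po_ob W;
    po_descl : forall W u v (e : u ∘ f = v ∘ g),
      @po_desc W u v e ∘ po_inl = u;
    po_descr : forall W u v (e : u ∘ f = v ∘ g),
      @po_desc W u v e ∘ po_inr = v;
    po_uniq : forall W (h k : hom po_ob W),
      h ∘ po_inl = k ∘ po_inl -> h ∘ po_inr = k ∘ po_inr -> h = k }.

(* In a double category, the horizontal 1-cells (objects of D_1) are presented
   as a family indexed by their source and target, so that the equations
   between objects of D_0 (SU = TU = 1, S(M ⊙ N) = SN, T(M ⊙ N) = TM) hold by
   typing.  The 2-morphisms (morphisms of D_1) are not indexed by their vertical
   boundary: the latter is given by the morphism parts [sqS], [sqT] of the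
   functors S and T, so that no transport occurs in the laws.  As usual,
   M ⊙ N is defined when the source of M is the target of N. *)
Record double_data := DoubleData {
  vcat :> category;
  hcell : vcat -> vcat -> Type;
  sq : forall A B A' B', hcell A B -> hcell A' B' -> Type;
  sqid : forall A B (M : hcell A B), sq M M;
  sqcomp : forall A B A' B' A'' B''
    (M : hcell A B) (M' : hcell A' B') (M'' : hcell A'' B''),
    sq M' M'' -> sq M M' -> sq M M'';
  sqS : forall A B A' B' (M : hcell A B) (M' : hcell A' B'),
    sq M M' -> hom A A';
  sqT : forall A B A' B' (M : hcell A B) (M' : hcell A' B'),
    sq M M' -> hom B B';
  hunit : forall A, hcell A A;
  hunit_sq : forall A A' (f : hom A A'), sq (hunit A) (hunit A');
  hcomp : forall A B C, hcell B C -> hcell A B -> hcell A C;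
  hcomp_sq : forall A B C A' B' C'
    (M : hcell B C) (N : hcell A B) (M' : hcell B' C') (N' : hcell A' B')
    (a : sq M M') (b : sq N N'), sqS a = sqT b ->
    sq (hcomp M N) (hcomp M' N');
  assoc : forall A B C D (M : hcell C D) (N : hcell B C) (K : hcell A B),
    sq (hcomp (hcomp M N) K) (hcomp M (hcomp N K));
  lunit : forall A B (M : hcell A B), sq (hcomp (hunit B) M) M;
  runit : forall A B (M : hcell A B), sq (hcomp M (hunit A)) M }.

Arguments hcell {d} A B.
Arguments sq {d A B A' B'} M M'.
Arguments sqid {d A B} M.
Arguments sqcomp {d A B A' B' A'' B'' M M' M''} b a.
Arguments sqS {d A B A' B' M M'} a.
Arguments sqT {d A B A' B' M M'} a.
Arguments hunit {d} A.
Arguments hunit_sq {d A A'} f.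
Arguments hcomp {d A B C} M N.
Arguments hcomp_sq {d A B C A' B' C' M N M' N'} a b e.
Arguments assoc {d A B C D} M N K.
Arguments lunit {d A B} M.
Arguments runit {d A B} M.

Notation "b • a" := (sqcomp b a) (at level 40, left associativity) : cat_scope.
Notation "M ⊙ N" := (hcomp M N) (at level 35, no associativity) : cat_scope.

Definition globular (D : double_data) (A B : D) (M N : hcell A B)
  (a : sq M N) : Prop := sqS a = idm A /\ sqT a = idm B.

Definition sq_iso (D : double_data) (A B A' B' : D)
    (M : hcell A B) (M' : hcell A' B') (a : sq M M') : Prop :=
  exists b : sq M' M, b • a = sqid M /\ a • b = sqid M'.

(* Hypotheses of the form [sqS a = sqT b] only say that a ⊙ b makes sense; they
   follow from the other laws wherever they are quantified over below. *)
Record double_category := DoubleCategory {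
  ddata :> double_data;
  sqcomp1m : forall (A B A' B' : ddata) (M : hcell A B) (M' : hcell A' B')
    (a : sq M M'), sqid M' • a = a;
  sqcompm1 : forall (A B A' B' : ddata) (M : hcell A B) (M' : hcell A' B')
    (a : sq M M'), a • sqid M = a;
  sqcompA : forall (A0 B0 A1 B1 A2 B2 A3 B3 : ddata)
    (M0 : hcell A0 B0) (M1 : hcell A1 B1)
    (M2 : hcell A2 B2) (M3 : hcell A3 B3)
    (c : sq M2 M3) (b : sq M1 M2) (a : sq M0 M1), c • (b • a) = (c • b) • a;
  sqS_id : forall (A B : ddata) (M : hcell A B), sqS (sqid M) = idm A;
  sqT_id : forall (A B : ddata) (M : hcell A B), sqT (sqid M) = idm B;
  sqS_comp : forall (A0 B0 A1 B1 A2 B2 : ddata)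
    (M0 : hcell A0 B0) (M1 : hcell A1 B1) (M2 : hcell A2 B2)
    (b : sq M1 M2) (a : sq M0 M1), sqS (b • a) = sqS b ∘ sqS a;
  sqT_comp : forall (A0 B0 A1 B1 A2 B2 : ddata)
    (M0 : hcell A0 B0) (M1 : hcell A1 B1) (M2 : hcell A2 B2)
    (b : sq M1 M2) (a : sq M0 M1), sqT (b • a) = sqT b ∘ sqT a;
  hunit_sqS : forall (A A' : ddata) (f : hom A A'), sqS (hunit_sq f) = f;
  hunit_sqT : forall (A A' : ddata) (f : hom A A'), sqT (hunit_sq f) = f;
  hunit_sq_id : forall A : ddata, hunit_sq (idm A) = sqid (hunit A);
  hunit_sq_comp : forall (A B C : ddata) (g : hom B C) (f : hom A B),
    hunit_sq (g ∘ f) = hunit_sq g • hunit_sq f;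
  hcomp_sqS : forall (A B C A' B' C' : ddata)
    (M : hcell B C) (N : hcell A B) (M' : hcell B' C') (N' : hcell A' B')
    (a : sq M M') (b : sq N N') e, sqS (hcomp_sq a b e) = sqS b;
  hcomp_sqT : forall (A B C A' B' C' : ddata)
    (M : hcell B C) (N : hcell A B) (M' : hcell B' C') (N' : hcell A' B')
    (a : sq M M') (b : sq N N') e, sqT (hcomp_sq a b e) = sqT a;
  hcomp_sq_id : forall (A B C : ddata) (M : hcell B C) (N : hcell A B) e,
    hcomp_sq (sqid M) (sqid N) e = sqid (M ⊙ N);
  hcomp_sq_comp : forall (A0 B0 C0 A1 B1 C1 A2 B2 C2 : ddata)
    (M0 : hcell B0 C0) (N0 : hcell A0 B0) (M1 : hcell B1 C1)
    (N1 : hcell A1 B1) (M2 : hcell B2 C2) (N2 : hcell A2 B2)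
    (a' : sq M1 M2) (a : sq M0 M1) (b' : sq N1 N2) (b : sq N0 N1) e e' e'',
    hcomp_sq (a' • a) (b' • b) e = hcomp_sq a' b' e' • hcomp_sq a b e'';
  assoc_iso : forall (A B C D : ddata)
    (M : hcell C D) (N : hcell B C) (K : hcell A B), sq_iso (assoc M N K);
  lunit_iso : forall (A B : ddata) (M : hcell A B), sq_iso (lunit M);
  runit_iso : forall (A B : ddata) (M : hcell A B), sq_iso (runit M);
  assoc_glob : forall (A B C D : ddata)
    (M : hcell C D) (N : hcell B C) (K : hcell A B), globular (assoc M N K);
  lunit_glob : forall (A B : ddata) (M : hcell A B), globular (lunit M);
  runit_glob : forall (A B : ddata) (M : hcell A B), globular (runit M);
  assoc_nat : forall (A B C D A' B' C' D' : ddata)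
    (M : hcell C D) (N : hcell B C) (K : hcell A B)
    (M' : hcell C' D') (N' : hcell B' C') (K' : hcell A' B')
    (a : sq M M') (b : sq N N') (c : sq K K') e1 e2 e3 e4,
    assoc M' N' K' • hcomp_sq (hcomp_sq a b e1) c e2 =
    hcomp_sq a (hcomp_sq b c e3) e4 • assoc M N K;
  lunit_nat : forall (A B A' B' : ddata) (M : hcell A B) (M' : hcell A' B')
    (a : sq M M') e, lunit M' • hcomp_sq (hunit_sq (sqT a)) a e = a • lunit M;
  runit_nat : forall (A B A' B' : ddata) (M : hcell A B) (M' : hcell A' B')
    (a : sq M M') e, runit M' • hcomp_sq a (hunit_sq (sqS a)) e = a • runit M;
  pentagon : forall (A B C D E : ddata) (M : hcell D E) (N : hcell C D)
    (K : hcell B C) (J : hcell A B) e e',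
    assoc M N (K ⊙ J) • assoc (M ⊙ N) K J =
    hcomp_sq (sqid M) (assoc N K J) e •
      (assoc M (N ⊙ K) J • hcomp_sq (assoc M N K) (sqid J) e');
  triangle : forall (A B C : ddata) (M : hcell B C) (N : hcell A B) e e',
    hcomp_sq (sqid M) (lunit N) e • assoc M (hunit B) N =
    hcomp_sq (runit M) (sqid N) e' }.

Definition sq_of_eq (D : double_data) (A B : D) (M N : hcell A B)
  (e : M = N) : sq M N := match e with erefl => sqid M end.

Definition strict (D : double_category) : Prop :=
  [/\ forall (A B C E : D) (M : hcell C E) (N : hcell B C) (K : hcell A B),
        exists e, assoc M N K = sq_of_eq e,
      forall (A B : D) (M : hcell A B), exists e, lunit M = sq_of_eq e
    & forall (A B : D) (M : hcell A B), exists e, runit M = sq_of_eq e].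

Record double_map (A B : double_data) := DoubleMap {
  on_ob :> A -> B;
  on_vert : forall X Y : A, hom X Y -> hom (on_ob X) (on_ob Y);
  on_hcell : forall X Y : A, hcell X Y -> hcell (on_ob X) (on_ob Y);
  on_sq : forall (X Y X' Y' : A) (M : hcell X Y) (M' : hcell X' Y'),
    sq M M' -> sq (on_hcell M) (on_hcell M') }.

(* As above, hypotheses [e] only express composability and are always
   satisfiable. *)
Record lax_double_functor (A B : double_category) := LaxDoubleFunctor {
  dmap :> double_map A B;
  on_vert_id : forall X : A, on_vert dmap (idm X) = idm (dmap X);
  on_vert_comp : forall (X Y Z : A) (g : hom Y Z) (f : hom X Y),
    on_vert dmap (g ∘ f) = on_vert dmap g ∘ on_vert dmap f;
  on_sq_id : forall (X Y : A) (M : hcell X Y),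
    on_sq dmap (sqid M) = sqid (on_hcell dmap M);
  on_sq_comp : forall (X0 Y0 X1 Y1 X2 Y2 : A)
    (M0 : hcell X0 Y0) (M1 : hcell X1 Y1) (M2 : hcell X2 Y2)
    (b : sq M1 M2) (a : sq M0 M1),
    on_sq dmap (b • a) = on_sq dmap b • on_sq dmap a;
  on_sqS : forall (X Y X' Y' : A) (M : hcell X Y) (M' : hcell X' Y')
    (a : sq M M'), sqS (on_sq dmap a) = on_vert dmap (sqS a);
  on_sqT : forall (X Y X' Y' : A) (M : hcell X Y) (M' : hcell X' Y')
    (a : sq M M'), sqT (on_sq dmap a) = on_vert dmap (sqT a);
  lax_comp : forall (X Y Z : A) (M : hcell Y Z) (N : hcell X Y),
    sq (on_hcell dmap M ⊙ on_hcell dmap N) (on_hcell dmap (M ⊙ N));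
  lax_unit : forall X : A, sq (hunit (dmap X)) (on_hcell dmap (hunit X));
  lax_comp_glob : forall (X Y Z : A) (M : hcell Y Z) (N : hcell X Y),
    globular (lax_comp M N);
  lax_unit_glob : forall X : A, globular (lax_unit X);
  lax_comp_nat : forall (X Y Z X' Y' Z' : A) (M : hcell Y Z) (N : hcell X Y)
    (M' : hcell Y' Z') (N' : hcell X' Y') (a : sq M M') (b : sq N N') e e',
    lax_comp M' N' • hcomp_sq (on_sq dmap a) (on_sq dmap b) e =
    on_sq dmap (hcomp_sq a b e') • lax_comp M N;
  lax_unit_nat : forall (X Y : A) (f : hom X Y),
    lax_unit Y • hunit_sq (on_vert dmap f) =
    on_sq dmap (hunit_sq f) • lax_unit X;
  lax_assoc : forall (X Y Z W : A)
    (M : hcell Z W) (N : hcell Y Z) (K : hcell X Y) e e',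
    on_sq dmap (assoc M N K) •
      (lax_comp (M ⊙ N) K •
         hcomp_sq (lax_comp M N) (sqid (on_hcell dmap K)) e) =
    lax_comp M (N ⊙ K) •
      (hcomp_sq (sqid (on_hcell dmap M)) (lax_comp N K) e' •
         assoc (on_hcell dmap M) (on_hcell dmap N) (on_hcell dmap K));
  lax_lunit : forall (X Y : A) (M : hcell X Y) e,
    on_sq dmap (lunit M) •
      (lax_comp (hunit Y) M •
         hcomp_sq (lax_unit Y) (sqid (on_hcell dmap M)) e) =
    lunit (on_hcell dmap M);
  lax_runit : forall (X Y : A) (M : hcell X Y) e,
    on_sq dmap (runit M) •
      (lax_comp M (hunit X) •
         hcomp_sq (sqid (on_hcell dmap M)) (lax_unit X) e) =
    runit (on_hcell dmap M) }.

Section Cospans.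
Context (A C : category) (L : functor A C).

Record cospan (X Y : A) := Cospan {
  apex : C;
  inleg : hom (L X) apex;
  outleg : hom (L Y) apex }.

Record cospan_map (X Y X' Y' : A) (M : cospan X Y) (M' : cospan X' Y') :=
  CospanMap {
    cm_left : hom X X';
    cm_apex : hom (apex M) (apex M');
    cm_right : hom Y Y';
    cm_in : cm_apex ∘ inleg M = inleg M' ∘ fmap L cm_left;
    cm_out : cm_apex ∘ outleg M = outleg M' ∘ fmap L cm_right }.

Lemma cospan_map_eq X Y X' Y' (M : cospan X Y) (M' : cospan X' Y')
    (a b : cospan_map M M') :
  cm_left a = cm_left b -> cm_apex a = cm_apex b -> cm_right a = cm_right b ->
  a = b.
Proof.
case: a => f a g p q; case: b => f' a' g' p' q' /= ef ea eg.
by subst; congr CospanMap; exact: Prop_irrelevance.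
Qed.

Program Definition cospan_id X Y (M : cospan X Y) : cospan_map M M :=
  @CospanMap _ _ _ _ M M (idm X) (idm (apex M)) (idm Y) _ _.
Next Obligation. by rewrite fmap1 comp1m compm1. Qed.
Next Obligation. by rewrite fmap1 comp1m compm1. Qed.

Program Definition cospan_comp X Y X' Y' X'' Y'' (M : cospan X Y)
    (M' : cospan X' Y') (M'' : cospan X'' Y'')
    (b : cospan_map M' M'') (a : cospan_map M M') : cospan_map M M'' :=
  @CospanMap _ _ _ _ M M'' (cm_left b ∘ cm_left a) (cm_apex b ∘ cm_apex a)
    (cm_right b ∘ cm_right a) _ _.
Next Obligation. by rewrite fmapM compA -cm_in -!compA cm_in. Qed.
Next Obligation. by rewrite fmapM compA -cm_out -!compA cm_out. Qed.

Definition cospan_unit X : cospan X X := Cospan (idm (L X)) (idm (L X)).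

Program Definition cospan_unit_map X Y (f : hom X Y) :
    cospan_map (cospan_unit X) (cospan_unit Y) :=
  @CospanMap _ _ _ _ (cospan_unit X) (cospan_unit Y) f (fmap L f) f _ _.
Next Obligation. by rewrite /= comp1m compm1. Qed.
Next Obligation. by rewrite /= comp1m compm1. Qed.

(* Composition of cospans depends on a choice of pushouts over the objects L Y;
   the double category below is defined for an arbitrary such choice. *)
Definition chosen_pushouts := forall (Y : A) (P Q : C)
  (f : hom (L Y) P) (g : hom (L Y) Q), pushout f g.

Context (po : chosen_pushouts).

Definition cospan_po X Y Z (M : cospan Y Z) (N : cospan X Y) :=
  po (outleg N) (inleg M).

Definition cospan_hcomp X Y Z (M : cospan Y Z) (N : cospan X Y) : cospan X Z :=
  Cospan (po_inl (cospan_po M N) ∘ inleg N) (po_inr (cospan_po M N) ∘ outleg M).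

Lemma descl Z P Q (f : hom Z P) (g : hom Z Q) (p : pushout f g) (W V : C)
    (u : hom P W) (v : hom Q W) (e : u ∘ f = v ∘ g) (k : hom V P) :
  po_desc p e ∘ (po_inl p ∘ k) = u ∘ k.
Proof. by rewrite compA po_descl. Qed.

Lemma descr Z P Q (f : hom Z P) (g : hom Z Q) (p : pushout f g) (W V : C)
    (u : hom P W) (v : hom Q W) (e : u ∘ f = v ∘ g) (k : hom V Q) :
  po_desc p e ∘ (po_inr p ∘ k) = v ∘ k.
Proof. by rewrite compA po_descr. Qed.

Section HcompMap.
Context X Y Z X' Y' Z' (M : cospan Y Z) (N : cospan X Y)
  (M' : cospan Y' Z') (N' : cospan X' Y')
  (a : cospan_map M M') (b : cospan_map N N') (e : cm_left a = cm_right b).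

Lemma cospan_hcomp_map_subproof :
  (po_inl (cospan_po M' N') ∘ cm_apex b) ∘ outleg N =
  (po_inr (cospan_po M' N') ∘ cm_apex a) ∘ inleg M.
Proof. by rewrite -!compA cm_in cm_out e !compA po_comm. Qed.

Program Definition cospan_hcomp_map :
    cospan_map (cospan_hcomp M N) (cospan_hcomp M' N') :=
  @CospanMap _ _ _ _ (cospan_hcomp M N) (cospan_hcomp M' N') (cm_left b)
    (po_desc (cospan_po M N) cospan_hcomp_map_subproof) (cm_right a) _ _.
Next Obligation. by rewrite /= descl -!compA cm_in. Qed.
Next Obligation. by rewrite /= descr -!compA cm_out. Qed.
End HcompMap.

Section Assoc.
Context X Y Z W (M : cospan Z W) (N : cospan Y Z) (K : cospan X Y).

Let pMN := cospan_po M N.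
Let pNK := cospan_po N K.
Let pl := cospan_po (cospan_hcomp M N) K.
Let pr := cospan_po M (cospan_hcomp N K).

Lemma cospan_assoc_subproof1 :
  (po_inl pr ∘ po_inr pNK) ∘ outleg N = po_inr pr ∘ inleg M.
Proof. by rewrite -compA (po_comm pr). Qed.

Lemma cospan_assoc_subproof2 :
  (po_inl pr ∘ po_inl pNK) ∘ outleg K =
  po_desc pMN cospan_assoc_subproof1 ∘ inleg (cospan_hcomp M N).
Proof. by rewrite /= descl -!compA (po_comm pNK). Qed.

Program Definition cospan_assoc : cospan_map
    (cospan_hcomp (cospan_hcomp M N) K) (cospan_hcomp M (cospan_hcomp N K)) :=
  @CospanMap _ _ _ _ (cospan_hcomp (cospan_hcomp M N) K)
    (cospan_hcomp M (cospan_hcomp N K)) (idm X)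
    (po_desc pl cospan_assoc_subproof2) (idm W) _ _.
Next Obligation. by rewrite /= descl fmap1 compm1 compA. Qed.
Next Obligation. by rewrite /= !descr fmap1 compm1. Qed.

Lemma cospan_assoc_subproof3 :
  po_inl pl ∘ outleg K = (po_inr pl ∘ po_inl pMN) ∘ inleg N.
Proof. by rewrite -compA (po_comm pl). Qed.

Lemma cospan_assoc_subproof4 :
  po_desc pNK cospan_assoc_subproof3 ∘ outleg (cospan_hcomp N K) =
  (po_inr pl ∘ po_inr pMN) ∘ inleg M.
Proof. by rewrite /= descr -!compA (po_comm pMN). Qed.

Program Definition cospan_assoc_inv : cospan_map
    (cospan_hcomp M (cospan_hcomp N K)) (cospan_hcomp (cospan_hcomp M N) K) :=
  @CospanMap _ _ _ _ (cospan_hcomp M (cospan_hcomp N K))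
    (cospan_hcomp (cospan_hcomp M N) K) (idm X)
    (po_desc pr cospan_assoc_subproof4) (idm W) _ _.
Next Obligation. by rewrite /= !descl fmap1 compm1. Qed.
Next Obligation. by rewrite /= descr fmap1 compm1 compA. Qed.
End Assoc.

Section Unitors.
Context X Y (M : cospan X Y).

Lemma cospan_lunit_subproof :
  idm (apex M) ∘ outleg M = outleg M ∘ inleg (cospan_unit Y).
Proof. by rewrite comp1m compm1. Qed.

Program Definition cospan_lunit :
    cospan_map (cospan_hcomp (cospan_unit Y) M) M :=
  @CospanMap _ _ _ _ (cospan_hcomp (cospan_unit Y) M) M (idm X)
    (po_desc (cospan_po (cospan_unit Y) M) cospan_lunit_subproof) (idm Y) _ _.
Next Obligation. by rewrite /= descl fmap1 comp1m compm1. Qed.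
Next Obligation. by rewrite /= descr fmap1 compm1. Qed.

Program Definition cospan_lunit_inv :
    cospan_map M (cospan_hcomp (cospan_unit Y) M) :=
  @CospanMap _ _ _ _ M (cospan_hcomp (cospan_unit Y) M) (idm X)
    (po_inl (cospan_po (cospan_unit Y) M)) (idm Y) _ _.
Next Obligation. by rewrite /= fmap1 compm1. Qed.
Next Obligation. by rewrite /= fmap1 compm1; exact: po_comm. Qed.

Lemma cospan_runit_subproof :
  inleg M ∘ outleg (cospan_unit X) = idm (apex M) ∘ inleg M.
Proof. by rewrite comp1m compm1. Qed.

Program Definition cospan_runit :
    cospan_map (cospan_hcomp M (cospan_unit X)) M :=
  @CospanMap _ _ _ _ (cospan_hcomp M (cospan_unit X)) M (idm X)
    (po_desc (cospan_po M (cospan_unit X)) cospan_runit_subproof) (idm Y) _ _.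
Next Obligation. by rewrite /= descl fmap1 compm1. Qed.
Next Obligation. by rewrite /= descr fmap1 comp1m compm1. Qed.

Program Definition cospan_runit_inv :
    cospan_map M (cospan_hcomp M (cospan_unit X)) :=
  @CospanMap _ _ _ _ M (cospan_hcomp M (cospan_unit X)) (idm X)
    (po_inr (cospan_po M (cospan_unit X))) (idm Y) _ _.
Next Obligation. by rewrite /= fmap1 compm1; exact/esym/po_comm. Qed.
Next Obligation. by rewrite /= fmap1 compm1. Qed.
End Unitors.

Definition cospan_double_data : double_data := @DoubleData A cospan cospan_map
  cospan_id cospan_comp cm_left cm_right cospan_unit cospan_unit_map
  cospan_hcomp cospan_hcomp_map cospan_assoc cospan_lunit cospan_runit.

Local Ltac nf := repeat (progress rewrite /= ?fmap1 ?fmapM ?comp1m ?compm1 -?compA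
  || rewrite descl || rewrite descr || rewrite po_descl || rewrite po_descr).
Local Ltac cospan_tac :=
  intros; apply: cospan_map_eq; nf => //; repeat (apply: po_uniq; nf => //).

Program Definition cospan_double_category : double_category :=
  @DoubleCategory cospan_double_data
    _ _ _ _ _ _ _ _ _ _ _ _ _ _ _ _ _ _ _ _ _ _ _ _ _ _.

Next Obligation. cospan_tac. Qed.
Next Obligation. cospan_tac. Qed.
Next Obligation. cospan_tac. Qed.
Next Obligation. done. Qed.
Next Obligation. done. Qed.
Next Obligation. done. Qed.
Next Obligation. done. Qed.
Next Obligation. done. Qed.
Next Obligation. done. Qed.
Next Obligation. cospan_tac. Qed.
Next Obligation. cospan_tac. Qed.
Next Obligation. done. Qed.
Next Obligation. done. Qed.
Next Obligation. cospan_tac. Qed.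
Next Obligation. cospan_tac. Qed.
Next Obligation. exists (cospan_assoc_inv M N K); split; cospan_tac. Qed.
Next Obligation. 
exists (cospan_lunit_inv M); split; cospan_tac.
by rewrite po_comm /= compm1.
Qed.
Next Obligation. 
exists (cospan_runit_inv M); split; cospan_tac.
by rewrite -po_comm /= compm1.
Qed.
Next Obligation. done. Qed.
Next Obligation. done. Qed.
Next Obligation. done. Qed.
Next Obligation. cospan_tac. Qed.
Next Obligation. by cospan_tac; rewrite cm_out. Qed.
Next Obligation. by cospan_tac; rewrite cm_in. Qed.
Next Obligation. cospan_tac. Qed.
Next Obligation. cospan_tac. by rewrite -po_comm. Qed.
End Cospans.

Arguments Cospan {A C L X Y} apex inleg outleg.

Definition SetCat : category :=
  @Category Type (fun X Y => X -> Y) (fun X => @id X)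
    (fun X Y Z g f => g \o f)
    (fun _ _ _ => erefl) (fun _ _ _ => erefl) (fun _ _ _ _ _ _ _ => erefl).

Section SetPushout.
Context (Z A B : Type) (f : Z -> A) (g : Z -> B).

Definition glue : A + B -> A + B -> Prop :=
  clos_refl_sym_trans _ (fun x y => exists z, x = inl (f z) /\ y = inr (g z)).

Definition set_po : Type := {c : set (A + B) | exists x, c = glue x}.

Definition set_po_class (x : A + B) : set_po :=
  exist _ (glue x : set (A + B)) (ex_intro _ x erefl).

Lemma set_po_class_eq x y : glue x y -> set_po_class x = set_po_class y.
Proof.
move=> xy; apply: eq_exist; apply/funext => z; apply/propext.
split=> h; first exact: rst_trans (rst_sym _ _ _ _ xy) h.
exact: rst_trans xy h.
Qed.

Lemma set_po_classP (c : set_po) : exists x, c = set_po_class x.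
Proof. by case: c => c [x e]; exists x; apply: eq_exist. Qed.

Definition set_po_repr (c : set_po) : A + B := projT1 (cid (set_po_classP c)).

Lemma set_po_reprK c : set_po_class (set_po_repr c) = c.
Proof. by rewrite /set_po_repr; case: cid. Qed.

Lemma set_po_repr_glue x : glue (set_po_repr (set_po_class x)) x.
Proof.
have /= -> := congr1 (fun c : set_po => sval c x) (set_po_reprK (set_po_class x)).
exact: rst_refl.
Qed.

Definition set_po_desc (W : Type) (u : A -> W) (v : B -> W) (c : set_po) : W :=
  match set_po_repr c with inl a => u a | inr b => v b end.

Lemma set_po_descE (W : Type) (u : A -> W) (v : B -> W) x :
  u \o f = v \o g ->
  set_po_desc u v (set_po_class x) = match x with inl a => u a | inr b => v b end.
Proof.
move=> e; rewrite /set_po_desc.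
move: (set_po_repr _) (set_po_repr_glue x) => y; elim=> {x y}.
- by move=> x y [z [-> ->]]; exact: (congr1 (fun h => h z) e).
- by [].
- by [].
- by move=> x y z _ -> _ ->.
Qed.

Definition set_po_inl : A -> set_po := set_po_class \o inl.
Definition set_po_inr : B -> set_po := set_po_class \o inr.

Lemma set_po_comm : set_po_inl \o f = set_po_inr \o g.
Proof.
by apply/funext => z; apply: set_po_class_eq; apply: rst_step; exists z.
Qed.

Lemma set_po_descl (W : Type) (u : A -> W) (v : B -> W) :
  u \o f = v \o g -> set_po_desc u v \o set_po_inl = u.
Proof. by move=> e; apply/funext => a /=; rewrite set_po_descE. Qed.

Lemma set_po_descr (W : Type) (u : A -> W) (v : B -> W) :
  u \o f = v \o g -> set_po_desc u v \o set_po_inr = v.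
Proof. by move=> e; apply/funext => a /=; rewrite set_po_descE. Qed.

Lemma set_po_uniq (W : Type) (h k : set_po -> W) :
  h \o set_po_inl = k \o set_po_inl -> h \o set_po_inr = k \o set_po_inr ->
  h = k.
Proof.
move=> el er; apply/funext => c; have [[a|b] ->] := set_po_classP c.
  exact: (congr1 (fun h => h a) el).
exact: (congr1 (fun h => h b) er).
Qed.
End SetPushout.

(* The free commutative monoid on X, as the finite multisets of elements of X
   (universal property: [free_cm]); its addition is `+` and its pointwise order
   is `<=`.  [{classic X}] is X with its classical choiceType structure. *)
Notation "ℕ[ X ]" := {mset {classic X}}%mset
  (at level 0, X at level 99, format "ℕ[ X ]") : type_scope.

(* ℕ[g], computed on the enumeration with multiplicity of a multiset.  It is the
   homomorphism extending g by [Nmap0], [NmapD] and [Nmap1]. *)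
Definition Nmap (X Y : Type) (g : X -> Y) (m : ℕ[X]) : ℕ[Y] :=
  seq_mset [seq (g x : {classic Y}) | x <- enum_mset m].

Section FreeCM.
Local Open Scope mset_scope.
Implicit Types X Y Z : Type.

Lemma Nmap_count X Y (g : X -> Y) (m : ℕ[X]) (y : {classic Y}) :
  Nmap g m y = count (fun x => (g x : {classic Y}) == y) m.
Proof. by rewrite mset_seqE count_map. Qed.

Lemma perm_enum_msetD (K : choiceType) (m n : {mset K}) :
  perm_eq (m `+` n) (enum_mset m ++ n).
Proof.
by apply/allP => x _ /=; rewrite count_cat !count_mem_mset msetE2.
Qed.

Lemma NmapD X Y (g : X -> Y) (m n : ℕ[X]) :
  Nmap g (m `+` n) = Nmap g m `+` Nmap g n.
Proof.
apply/msetP => y; rewrite msetE2 !Nmap_count.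
by rewrite (permP (perm_enum_msetD m n)) count_cat.
Qed.

Lemma Nmap0 X Y (g : X -> Y) : Nmap g mset0 = mset0.
Proof. by apply/msetP => y; rewrite Nmap_count enum_mset0 mset0E. Qed.

Lemma Nmap1 X Y (g : X -> Y) (x : {classic X}) :
  Nmap g [mset x] = [mset (g x : {classic Y})].
Proof.
apply/msetP => y; rewrite Nmap_count enum_msetn /= addn0 msetnE.
by rewrite eq_sym; case: eqP.
Qed.

Lemma Nmap_id X : Nmap (@id X) = id.
Proof.
apply/funext => m; apply/msetP => y.
by rewrite Nmap_count -[RHS]count_mem_mset.
Qed.

Lemma Nmap_comp X Y Z (g : Y -> Z) (f : X -> Y) :
  Nmap (g \o f) = Nmap g \o Nmap f.
Proof.
apply/funext => m; apply/msetP => z /=; rewrite !Nmap_count.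
have /permP/(_ (fun y => (g y : {classic Z}) == z)) -> :=
  perm_eq_seq_mset [seq (f x : {classic Y}) | x <- enum_mset m].
by rewrite count_map.
Qed.

Lemma free_cm X (V : Type) (zero : V) (add : Monoid.com_law zero) (f : X -> V) :
  exists! h : ℕ[X] -> V,
    [/\ h mset0 = zero, {morph h : m n / m `+` n >-> add m n}
      & forall x : {classic X}, h [mset x] = f x].
Proof.
exists (fun m : ℕ[X] => \big[add/zero]_(x <- enum_mset m) f x); split.
  split=> [|m n|x]; first by rewrite enum_mset0 big_nil.
    by rewrite (perm_big _ (perm_enum_msetD m n)) big_cat.
  by rewrite enum_msetn big_seq1.
move=> h [h0 hD h1]; apply/funext => m; rewrite -[in RHS](seq_mset_id m).
elim: (enum_mset m) => [|x s IHs].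
  rewrite big_nil -h0; congr h; apply/msetP => y.
  by rewrite mset_seqE mset0E.
rewrite big_cons IHs -h1 -hD; congr h; apply/msetP => y.
by rewrite mset1DE !mset_seqE /= eq_sym.
Qed.
End FreeCM.

Record petri := Petri {
  transition : Type;
  place : Type;
  source : transition -> ℕ[place];
  target : transition -> ℕ[place] }.

Record petri_hom (P Q : petri) := PetriHom {
  on_trans : transition P -> transition Q;
  on_place : place P -> place Q;
  on_source : @source Q \o on_trans = Nmap on_place \o @source P;
  on_target : @target Q \o on_trans = Nmap on_place \o @target P }.

Lemma petri_hom_eq P Q (a b : petri_hom P Q) :
  on_trans a = on_trans b -> on_place a = on_place b -> a = b.
Proof.
case: a => f g p q; case: b => f' g' p' q' /= ef eg.
by subst; congr PetriHom; exact: Prop_irrelevance.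
Qed.

Program Definition petri_id P : petri_hom P P := @PetriHom P P id id _ _.
Next Obligation. by rewrite Nmap_id. Qed.
Next Obligation. by rewrite Nmap_id. Qed.

Program Definition petri_comp P Q R (b : petri_hom Q R) (a : petri_hom P Q) :
    petri_hom P R :=
  @PetriHom P R (on_trans b \o on_trans a) (on_place b \o on_place a) _ _.
Next Obligation.
rewrite Nmap_comp; apply/funext => t /=.
have /= -> := congr1 (fun h => h (on_trans a t)) (on_source b).
by have /= -> := congr1 (fun h => h t) (on_source a).
Qed.
Next Obligation.
rewrite Nmap_comp; apply/funext => t /=.
have /= -> := congr1 (fun h => h (on_trans a t)) (on_target b).
by have /= -> := congr1 (fun h => h t) (on_target a).
Qed.

Program Definition Petri_cat : category :=
  @Category petri petri_hom petri_id petri_comp _ _ _.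
Next Obligation. exact: petri_hom_eq. Qed.
Next Obligation. exact: petri_hom_eq. Qed.
Next Obligation. exact: petri_hom_eq. Qed.

Definition discrete_net (X : Type) : petri :=
  @Petri void X (of_void _) (of_void _).

Program Definition discrete_net_map (X Y : Type) (f : X -> Y) :
    petri_hom (discrete_net X) (discrete_net Y) :=
  @PetriHom (discrete_net X) (discrete_net Y) id f _ _.
Next Obligation. by apply/funext; case. Qed.
Next Obligation. by apply/funext; case. Qed.

Program Definition L : functor SetCat Petri_cat :=
  @Functor SetCat Petri_cat discrete_net discrete_net_map _ _.
Next Obligation. exact: petri_hom_eq. Qed.
Next Obligation. exact: petri_hom_eq. Qed.

Section PetriPushout.
Context (Z P Q : petri) (f : petri_hom Z P) (g : petri_hom Z Q).

Let poT := set_po (on_trans f) (on_trans g).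
Let poS := set_po (on_place f) (on_place g).
Let inlT : transition P -> poT := set_po_inl _ _.
Let inrT : transition Q -> poT := set_po_inr _ _.
Let inlS : place P -> poS := set_po_inl _ _.
Let inrS : place Q -> poS := set_po_inr _ _.

Lemma petri_po_subproof (h : forall R : petri, transition R -> ℕ[place R]) :
  h P \o on_trans f = Nmap (on_place f) \o h Z ->
  h Q \o on_trans g = Nmap (on_place g) \o h Z ->
  (Nmap inlS \o h P) \o on_trans f = (Nmap inrS \o h Q) \o on_trans g.
Proof.
move=> hf hg; rewrite -[LHS]/(Nmap inlS \o (h P \o on_trans f)) hf.
rewrite -[RHS]/(Nmap inrS \o (h Q \o on_trans g)) hg.
rewrite -[LHS]/((Nmap inlS \o Nmap (on_place f)) \o h Z).
rewrite -[RHS]/((Nmap inrS \o Nmap (on_place g)) \o h Z).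
by rewrite -!Nmap_comp set_po_comm.
Qed.

Definition petri_po : petri := @Petri poT poS
  (set_po_desc (Nmap inlS \o @source P) (Nmap inrS \o @source Q))
  (set_po_desc (Nmap inlS \o @target P) (Nmap inrS \o @target Q)).

Program Definition petri_po_inl : petri_hom P petri_po :=
  @PetriHom P petri_po inlT inlS _ _.
Next Obligation.
by apply/set_po_descl/petri_po_subproof; [exact: on_source..].
Qed.
Next Obligation.
by apply/set_po_descl/petri_po_subproof; [exact: on_target..].
Qed.

Program Definition petri_po_inr : petri_hom Q petri_po :=
  @PetriHom Q petri_po inrT inrS _ _.
Next Obligation.
by apply/set_po_descr/petri_po_subproof; [exact: on_source..].
Qed.
Next Obligation.
by apply/set_po_descr/petri_po_subproof; [exact: on_target..].
Qed.

Section Desc.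
Context (W : petri) (u : petri_hom P W) (v : petri_hom Q W).
Context (e : petri_comp u f = petri_comp v g).

Let eT : on_trans u \o on_trans f = on_trans v \o on_trans g :=
  congr1 (@on_trans _ _) e.
Let eS : on_place u \o on_place f = on_place v \o on_place g :=
  congr1 (@on_place _ _) e.

Lemma petri_po_desc_subproof
    (h : forall R : petri, transition R -> ℕ[place R]) :
  h P \o on_trans f = Nmap (on_place f) \o h Z ->
  h Q \o on_trans g = Nmap (on_place g) \o h Z ->
  h W \o on_trans u = Nmap (on_place u) \o h P ->
  h W \o on_trans v = Nmap (on_place v) \o h Q ->
  h W \o set_po_desc (on_trans u) (on_trans v) =
  Nmap (set_po_desc (on_place u) (on_place v)) \o
    (set_po_desc (Nmap inlS \o h P) (Nmap inrS \o h Q) : poT -> ℕ[poS]).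
Proof.
move=> hf hg hu hv; have hfg := petri_po_subproof hf hg.
set dT := set_po_desc (on_trans u) _; set dS := set_po_desc (on_place u) _.
set dh := set_po_desc _ _; apply: set_po_uniq.
- rewrite -[LHS]/(h W \o (dT \o _)) -[RHS]/(Nmap dS \o (dh \o _)).
  rewrite !set_po_descl // hu -[in LHS](set_po_descl eS).
  by rewrite Nmap_comp.
- rewrite -[LHS]/(h W \o (dT \o _)) -[RHS]/(Nmap dS \o (dh \o _)).
  rewrite !set_po_descr // hv -[in LHS](set_po_descr eS).
  by rewrite Nmap_comp.
Qed.

Program Definition petri_po_desc : petri_hom petri_po W :=
  @PetriHom petri_po W (set_po_desc (on_trans u) (on_trans v))
    (set_po_desc (on_place u) (on_place v)) _ _.
Next Obligation.
by apply: (petri_po_desc_subproof (h := source)); exact: on_source.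
Qed.
Next Obligation.
by apply: (petri_po_desc_subproof (h := target)); exact: on_target.
Qed.
End Desc.

Program Definition petri_pushout : @pushout Petri_cat Z P Q f g :=
  @Pushout Petri_cat Z P Q f g petri_po petri_po_inl petri_po_inr
    _ petri_po_desc _ _ _.
Next Obligation. by apply: petri_hom_eq; exact: set_po_comm. Qed.
Next Obligation.
apply: petri_hom_eq; apply: set_po_descl; first exact: (congr1 (@on_trans _ _) e).
exact: (congr1 (@on_place _ _) e).
Qed.
Next Obligation.
apply: petri_hom_eq; apply: set_po_descr; first exact: (congr1 (@on_trans _ _) e).
exact: (congr1 (@on_place _ _) e).
Qed.
Next Obligation.
by apply: petri_hom_eq; apply: set_po_uniq;
  [exact: (congr1 (@on_trans _ _) H) | exact: (congr1 (@on_trans _ _) H0)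
  |exact: (congr1 (@on_place _ _) H) | exact: (congr1 (@on_place _ _) H0)].
Qed.
End PetriPushout.

(* Petri has all pushouts, so choices of pushouts over L exist. *)
Definition petri_pushouts : chosen_pushouts L :=
  fun Y P Q f g => petri_pushout f g.

Definition OpenPetri (po : chosen_pushouts L) : double_category :=
  cospan_double_category po.

Section Rel.
Implicit Types X Y Z : Type.
Local Open Scope classical_set_scope.

Record rel_square X Y X' Y' (R : set (X * Y)) (R' : set (X' * Y')) :=
  RelSquare {
    rel_left : X -> X';
    rel_right : Y -> Y';
    rel_incl : [set (rel_left p.1, rel_right p.2) | p in R] `<=` R' }.

Lemma rel_square_eq X Y X' Y' (R : set (X * Y)) (R' : set (X' * Y'))
    (a b : rel_square R R') :
  rel_left a = rel_left b -> rel_right a = rel_right b -> a = b.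
Proof.
case: a => f g p; case: b => f' g' p' /= ef eg.
by subst; congr RelSquare; exact: Prop_irrelevance.
Qed.

Lemma rel_inclE X Y X' Y' (R : set (X * Y)) (R' : set (X' * Y'))
    (a : rel_square R R') x y : R (x, y) -> R' (rel_left a x, rel_right a y).
Proof. by move=> Rxy; apply: (@rel_incl _ _ _ _ _ _ a); exists (x, y). Qed.

Program Definition rel_id X Y (R : set (X * Y)) : rel_square R R :=
  @RelSquare _ _ _ _ R R id id _.
Next Obligation. by move=> _ [[x y] Rxy <-]. Qed.

Program Definition rel_vcomp X Y X' Y' X'' Y'' (R : set (X * Y))
    (R' : set (X' * Y')) (R'' : set (X'' * Y''))
    (b : rel_square R' R'') (a : rel_square R R') : rel_square R R'' :=
  @RelSquare _ _ _ _ R R'' (rel_left b \o rel_left a)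
    (rel_right b \o rel_right a) _.
Next Obligation.
by move=> _ [[x y] Rxy <-]; do 2!apply: rel_inclE.
Qed.

Definition rel_diag X : set (X * X) := range (fun x => (x, x)).

Program Definition rel_diag_sq X Y (f : X -> Y) :
    rel_square (rel_diag (X := X)) (rel_diag (X := Y)) :=
  @RelSquare _ _ _ _ (rel_diag (X := X)) (rel_diag (X := Y)) f f _.
Next Obligation. by move=> _ [_ [x _ <-] <-]; exists (f x). Qed.

Definition rel_hcomp X Y Z (S : set (Y * Z)) (R : set (X * Y)) : set (X * Z) :=
  (S \; R)%relation.

Program Definition rel_hcomp_sq X Y Z X' Y' Z'
    (S : set (Y * Z)) (R : set (X * Y)) (S' : set (Y' * Z')) (R' : set (X' * Y'))
    (a : rel_square S S') (b : rel_square R R') (e : rel_left a = rel_right b) :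
    rel_square (rel_hcomp S R) (rel_hcomp S' R') :=
  @RelSquare _ _ _ _ (rel_hcomp S R) (rel_hcomp S' R')
    (rel_left b) (rel_right a) _.
Next Obligation.
move=> _ [[x z] [y Rxy Syz] <-]; exists (rel_right b y) => /=.
  exact: rel_inclE.
by rewrite -e; exact: rel_inclE.
Qed.

Definition rel_sq_of_eq X Y (R S : set (X * Y)) (e : R = S) : rel_square R S :=
  match e with erefl => rel_id R end.

Lemma rel_hcompA X Y Z W (T : set (Z * W)) (S : set (Y * Z)) (R : set (X * Y)) :
  rel_hcomp (rel_hcomp T S) R = rel_hcomp T (rel_hcomp S R).
Proof.
apply/seteqP; split=> -[x w].
  by move=> [y Rxy [z Syz Tzw]]; exists z => //; exists y.
by move=> [z [y Rxy Syz] Tzw]; exists y => //; exists z.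
Qed.

Lemma rel_hcomp1m X Y (R : set (X * Y)) : rel_hcomp (rel_diag (X := Y)) R = R.
Proof.
apply/seteqP; split=> -[x y]; last by move=> Rxy; exists y => //; exists y.
by move=> [y' Rxy [y'' _ [-> <-]]].
Qed.

Lemma rel_hcompm1 X Y (R : set (X * Y)) : rel_hcomp R (rel_diag (X := X)) = R.
Proof.
apply/seteqP; split=> -[x y]; last by move=> Rxy; exists x => //; exists x.
by move=> [x' [x'' _ [<- <-]]].
Qed.

(* The associator and unitors are the identities, along the equalities of
   relations above; cf. [Rel_strict]. *)
Definition rel_double_data : double_data :=
  @DoubleData SetCat (fun X Y => set (X * Y)) rel_square rel_id rel_vcomp
    rel_left rel_right rel_diag rel_diag_sq rel_hcomp rel_hcomp_sq
    (fun X Y Z W T S R => rel_sq_of_eq (rel_hcompA T S R))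
    (fun X Y R => rel_sq_of_eq (rel_hcomp1m R))
    (fun X Y R => rel_sq_of_eq (rel_hcompm1 R)).

Lemma rel_sq_of_eq_left X Y (R S : set (X * Y)) (e : R = S) :
  rel_left (rel_sq_of_eq e) = id.
Proof. by case: _ / e. Qed.

Lemma rel_sq_of_eq_right X Y (R S : set (X * Y)) (e : R = S) :
  rel_right (rel_sq_of_eq e) = id.
Proof. by case: _ / e. Qed.

Lemma rel_sq_of_eq_iso X Y (R S : set (X * Y)) (e : R = S) :
  @sq_iso rel_double_data X Y X Y R S (rel_sq_of_eq e).
Proof. by case: _ / e; exists (rel_id R); split; exact: rel_square_eq. Qed.

Local Ltac rel_tac := intros; apply: rel_square_eq;
  rewrite /= ?rel_sq_of_eq_left ?rel_sq_of_eq_right.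

Program Definition Rel : double_category :=
  @DoubleCategory rel_double_data
    _ _ _ _ _ _ _ _ _ _ _ _ _ _ _ _ _ _ _ _ _ _ _ _ _ _.
Next Obligation. by rel_tac. Qed.
Next Obligation. by rel_tac. Qed.
Next Obligation. by rel_tac. Qed.
Next Obligation. by []. Qed.
Next Obligation. by []. Qed.
Next Obligation. by []. Qed.
Next Obligation. by []. Qed.
Next Obligation. by []. Qed.
Next Obligation. by []. Qed.
Next Obligation. by rel_tac. Qed.
Next Obligation. by rel_tac. Qed.
Next Obligation. by []. Qed.
Next Obligation. by []. Qed.
Next Obligation. by rel_tac. Qed.
Next Obligation. by rel_tac. Qed.
Next Obligation. exact: rel_sq_of_eq_iso. Qed.
Next Obligation. exact: rel_sq_of_eq_iso. Qed.
Next Obligation. exact: rel_sq_of_eq_iso. Qed.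
Next Obligation.
by split; rewrite /= ?rel_sq_of_eq_left ?rel_sq_of_eq_right.
Qed.
Next Obligation.
by split; rewrite /= ?rel_sq_of_eq_left ?rel_sq_of_eq_right.
Qed.
Next Obligation.
by split; rewrite /= ?rel_sq_of_eq_left ?rel_sq_of_eq_right.
Qed.
Next Obligation. by rel_tac. Qed.
Next Obligation. by rel_tac. Qed.
Next Obligation. by rel_tac. Qed.
Next Obligation. by rel_tac. Qed.
Next Obligation. by rel_tac. Qed.

Lemma Rel_strict : strict Rel.
Proof.
split=> *; [exists (rel_hcompA _ _ _)|exists (rel_hcomp1m _)
  |exists (rel_hcompm1 _)]; by [].
Qed.
End Rel.

Section Reachability.
Context (P : petri).
Local Open Scope mset_scope.

Definition firing (t : transition P) (m n : ℕ[place P]) : Prop :=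
  source t `<=` m /\ n `+` source t = m `+` target t.

Definition reachable (m n : ℕ[place P]) : Prop :=
  exists (k : nat) (ms : nat -> ℕ[place P]),
    [/\ 1 <= k, ms 1 = m, ms k = n
      & forall i, 1 <= i <= k - 1 -> exists t, firing t (ms i) (ms i.+1)].
End Reachability.

Definition reachability (X Y : Type) (P : cospan L X Y) : set (ℕ[X] * ℕ[Y]) :=
  [set xy | reachable (Nmap (on_place (inleg P)) xy.1)
                      (Nmap (on_place (outleg P)) xy.2)]%classic.

(* Main.v *)
Require Import Defs.
From mathcomp Require Import all_boot boolp classical_sets finmap multiset.
From mathcomp Require Import zify.

Set Implicit Arguments.
Unset Strict Implicit.
Unset Printing Implicit Defensive.

(** A morphism of nets sends firings to firings, hence preserves reachability;
    this gives the action on 2-morphisms.  Firing sequences of two composable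
    nets, pushed forward along the injections into the pushout, can be
    concatenated because the two outer images of a marking of the shared
    interface agree there; this gives the laxator, and reflexivity of
    reachability gives the unit comparison.  All remaining laws hold because a
    square of relations is determined by its vertical sides. *)

Section Reachable.
Local Open Scope mset_scope.

Lemma reachable_refl (P : petri) (m : ℕ[place P]) : reachable m m.
Proof. by exists 1, (fun=> m); split=> // -[|[]]. Qed.

Lemma reachable_trans (P : petri) (m n p : ℕ[place P]) :
  reachable m n -> reachable n p -> reachable m p.
Proof.
move=> [k [ms [k_gt0 ms1 msk fire]]] [l [ns [l_gt0 ns1 nsl fire']]].
(* Markings are numbered from 1 and the two sequences share the marking [n], so the joint one has
   [k + l - 1] terms; [ns] is shifted so that its first term falls on index [k]. *)
exists (k + l.-1), (fun i => if i <= k then ms i else ns (i.+1 - k)).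
split=> [|||i /andP[i_gt0 ile]].
- by rewrite ltn_addr.
- by rewrite k_gt0.
- case: l l_gt0 nsl {fire'} => // -[|l] _ nsl /=.
    by rewrite addn0 leqnn msk -ns1.
  by rewrite leqNgt -addSnnS ltnS leq_addr /= -addnS addSnnS addKn.
- have [ltik|leki] := ltnP i k.
    by rewrite ltnW //; apply: fire; rewrite i_gt0 -ltnS subn1 prednK.
  (* At the junction [i = k] the two branches agree, since [ms k = n = ns 1]; hence from [k] on
     every step comes from the second sequence. *)
  have -> : (if i <= k then ms i else ns (i.+1 - k)) = ns (i.+1 - k).
    have [leik|//] := leqP i k.
    have -> : i = k by apply/eqP; rewrite eqn_leq leik.
    by rewrite msk subSnn ns1.
  rewrite !subSn ?leqW //; apply: fire'.
  by move: i_gt0 k_gt0 leki ile; clear; lia.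
Qed.

(** The order on markings comes from addition: [n] is [m] plus a remainder, and [Nmap g] is
    additive. *)
Lemma Nmap_sub (X Y : Type) (g : X -> Y) (m n : ℕ[X]) :
  m `<=` n -> Nmap g m `<=` Nmap g n.
Proof.
move=> /msetBDKC <-; rewrite NmapD.
by apply/msubsetP => x; rewrite msetE2 leq_addr.
Qed.

Lemma firing_map (P Q : petri) (h : petri_hom P Q) (t : transition P)
    (m n : ℕ[place P]) :
  firing t m n ->
  firing (on_trans h t) (Nmap (on_place h) m) (Nmap (on_place h) n).
Proof.
move=> [le_m eq_n].
have src : source (on_trans h t) = Nmap (on_place h) (source t).
  exact: (congr1 (fun k => k t) (on_source h)).
have tgt : target (on_trans h t) = Nmap (on_place h) (target t).
  exact: (congr1 (fun k => k t) (on_target h)).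
by split; rewrite src ?tgt -?NmapD ?eq_n //; exact: Nmap_sub.
Qed.

Lemma reachable_map (P Q : petri) (h : petri_hom P Q) (m n : ℕ[place P]) :
  reachable m n -> reachable (Nmap (on_place h) m) (Nmap (on_place h) n).
Proof.
move=> [k [ms [k_gt0 <- <- fire]]]; exists k, (Nmap (on_place h) \o ms).
split=> // i /fire[t /(firing_map h) fire_t]; by exists (on_trans h t).
Qed.
End Reachable.

Lemma Nmap_petri_comp (P Q R : petri) (h : petri_hom Q R) (g : petri_hom P Q)
    (m : ℕ[place P]) :
  Nmap (on_place (petri_comp h g)) m = Nmap (on_place h) (Nmap (on_place g) m).
Proof. exact: (congr1 (fun k => k m) (Nmap_comp (on_place h) (on_place g))). Qed.

(** Transfers the squares [cm_in], [cm_out] and [po_comm] from nets to markings. *)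
Lemma Nmap_petri_square (P Q Q' R : petri) (h : petri_hom Q R)
    (g : petri_hom P Q) (h' : petri_hom Q' R) (g' : petri_hom P Q') :
  petri_comp h g = petri_comp h' g' -> forall m : ℕ[place P],
  Nmap (on_place h) (Nmap (on_place g) m) =
  Nmap (on_place h') (Nmap (on_place g') m).
Proof. by move=> e m; rewrite -!Nmap_petri_comp e. Qed.

Lemma reachability_map (X Y X' Y' : Type) (P : cospan L X Y)
    (P' : cospan L X' Y') (a : cospan_map P P') :
  ([set (Nmap (cm_left a) p.1, Nmap (cm_right a) p.2) | p in reachability P]
     `<=` reachability P')%classic.
Proof.
move=> _ [[x y] /(reachable_map (cm_apex a)) xy <-].
move: xy; rewrite (Nmap_petri_square (cm_in a) x).
by rewrite (Nmap_petri_square (cm_out a) y).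
Qed.

Section Reachability_functor.
Context (po : chosen_pushouts L).

Definition reachability_sq (X Y X' Y' : Type) (P : cospan L X Y)
    (P' : cospan L X' Y') (a : cospan_map P P') :
    rel_square (reachability P) (reachability P') :=
  RelSquare (reachability_map (a := a)).

Definition reachability_dmap : double_map (OpenPetri po) Rel :=
  @DoubleMap (OpenPetri po) Rel (fun X : Type => ℕ[X])
    (fun (X Y : Type) (f : X -> Y) => Nmap f)
    (fun (X Y : Type) (P : cospan L X Y) => reachability P)
    reachability_sq.

(** Only this inclusion holds in general: in the composite net tokens may cross the interface back
    and forth, which a single intermediate marking [y] cannot record. *)
Lemma reachability_hcomp (X Y Z : Type) (M : cospan L Y Z) (N : cospan L X Y) :
  ([set (id p.1, id p.2) | p in rel_hcomp (reachability M) (reachability N)]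
     `<=` reachability (cospan_hcomp po M N))%classic.
Proof.
move=> _ [[x z] [y xy yz] <-].
have xy' := reachable_map (po_inl (cospan_po po M N)) xy.
have yz' := reachable_map (po_inr (cospan_po po M N)) yz.
rewrite -(Nmap_petri_square (po_comm (cospan_po po M N)) y) in yz'.
have ex := Nmap_petri_comp (po_inl (cospan_po po M N)) (inleg N) x.
have ez := Nmap_petri_comp (po_inr (cospan_po po M N)) (outleg M) z.
by rewrite -ex in xy'; rewrite -ez in yz'; exact: reachable_trans xy' yz'.
Qed.

(** Both legs are identities, so a diagonal pair yields the same marking twice. *)
Lemma reachability_unit (X : Type) :
  ([set (id p.1, id p.2) | p in rel_diag (X := ℕ[X])]
     `<=` reachability (cospan_unit L X))%classic.
Proof. by move=> _ [_ [x _ <-] <-]; exact: reachable_refl. Qed.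

#[local] Obligation Tactic := intros.

Program Definition reachability_functor :
    lax_double_functor (OpenPetri po) Rel :=
  @LaxDoubleFunctor (OpenPetri po) Rel reachability_dmap
    _ _ _ _ _ _
    (fun X Y Z M N => RelSquare (@reachability_hcomp X Y Z M N))
    (fun X => RelSquare (@reachability_unit X))
    _ _ _ _ _ _ _.
Next Obligation. exact: Nmap_id. Qed.
Next Obligation. exact: Nmap_comp. Qed.
Next Obligation. by apply: rel_square_eq; exact: Nmap_id. Qed.
Next Obligation. by apply: rel_square_eq; exact: Nmap_comp. Qed.
Next Obligation. by []. Qed.
Next Obligation. by []. Qed.
Next Obligation. by []. Qed.
Next Obligation. by []. Qed.
Next Obligation. by apply: rel_square_eq. Qed.
Next Obligation. by apply: rel_square_eq. Qed.
(* The associator and unitors of [Rel] are casts along equalities of relations, so their sides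
   become identities only by rewriting; the images of those of [OpenPetri po] have sides
   [Nmap id]. *)
Next Obligation.
by apply: rel_square_eq; rewrite /= ?rel_sq_of_eq_left ?rel_sq_of_eq_right Nmap_id.
Qed.
Next Obligation.
by apply: rel_square_eq; rewrite /= ?rel_sq_of_eq_left ?rel_sq_of_eq_right Nmap_id.
Qed.
Next Obligation.
by apply: rel_square_eq; rewrite /= ?rel_sq_of_eq_left ?rel_sq_of_eq_right Nmap_id.
Qed.
End Reachability_functor.

(** With [incl] quantified first, one equation fixes all the data of [F]; by proof irrelevance the
    choice of [incl] does not affect the squares. *)
Theorem theorem23 (po : chosen_pushouts L) :
  exists incl : forall (X Y X' Y' : Type)
      (P : cospan L X Y) (P' : cospan L X' Y') (a : cospan_map P P'),
      ([set (Nmap (cm_left a) p.1, Nmap (cm_right a) p.2)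
         | p in reachability P] `<=` reachability P')%classic,
  exists F : lax_double_functor (OpenPetri po) Rel,
    dmap F = @DoubleMap (OpenPetri po) Rel
      (fun X : Type => ℕ[X])
      (fun (X Y : Type) (f : X -> Y) => Nmap f)
      (fun (X Y : Type) (P : cospan L X Y) => reachability P)
      (fun (X Y X' Y' : Type) (P : cospan L X Y) (P' : cospan L X' Y')
           (a : cospan_map P P') =>
         RelSquare (incl X Y X' Y' P P' a)).
Proof. by exists reachability_map, (reachability_functor po). Qed.
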